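(* Let $S$ be a non-empty set of primes. There exists a profinite group $G$ with the following properties: (1) $G$ is topologically perfect, i.e. $G=\overline{G'}$; (2) $\overline{G^{m}}$ is open in $G$ for each $m\in\mathbb{N}$, and for each $k\in\mathbb{N}$, $G$ has only finitely many open subgroups of index $k$; (3) if $m\in\mathbb{N}$ is coprime to every prime in $S$, then $G^{m}$ is open in $G$, and $G$ has only finitely many normal subgroups of index $m$; (4) if $p\in S$ then $G/G'G^{p}$ is infinite, and $G$ has uncountably many normal subgroups of index $p$, none of which is open; (5) $G'$ is not closed in $G$, and $G^{p}$ is not closed in $G$ for each $p\in S$.
   Context: For a group $G$, $G'$ denotes the (abstract) derived subgroup, i.e. the subgroup generated algebraically by all commutators, and for $m\in\mathbb{N}$, $G^{m}$ denotes the (abstract) subgroup generated algebraically by the set $\{g^m\mid g\in G\}$ of $m$th powers. $\overline{X}$ denotes the topological closure of a subset $X$ of a profinite group. Subgroups and normal subgroups of finite index referred to are abstract subgroups (not necessarily closed), unless said to be open. *)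

(* Defs.v *)
From HB Require Import structures.
From mathcomp Require Import all_boot all_order.
From mathcomp Require Import all_classical all_reals all_analysis.
Unset Printing Implicit Defensive.
Local Open Scope classical_set_scope.

Record profinite_group := ProfiniteGroup {
  pg_carrier :> topologicalType;
  pg_mul : pg_carrier -> pg_carrier -> pg_carrier;
  pg_one : pg_carrier;
  pg_inv : pg_carrier -> pg_carrier;
  pg_mulA : forall x y z, pg_mul x (pg_mul y z) = pg_mul (pg_mul x y) z;
  pg_mul1g : forall x, pg_mul pg_one x = x;
  pg_mulVg : forall x, pg_mul (pg_inv x) x = pg_one;
  pg_mul_cont : continuous (fun p : pg_carrier * pg_carrier => pg_mul p.1 p.2);
  pg_inv_cont : continuous pg_inv;
  pg_compact : compact [set: pg_carrier];
  pg_hausdorff : hausdorff_space pg_carrier;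
  pg_tdisc : totally_disconnected [set: pg_carrier]
}.

Section Defs.
Variable G : profinite_group.
Local Notation "x * y" := (@pg_mul G x y).
Local Notation "x ^-1" := (@pg_inv G x).

Fixpoint pg_exp (g : G) (m : nat) : G :=
  match m with O => pg_one G | S m' => g * pg_exp g m' end.

Definition commutator (x y : G) : G := x^-1 * (y^-1 * (x * y)).

Definition is_subgroup (H : set G) : Prop :=
  H (pg_one G) /\ (forall x y, H x -> H y -> H (x * y)) /\ (forall x, H x -> H (x^-1)).

Definition is_normal (H : set G) : Prop :=
  is_subgroup H /\ (forall g x, H x -> H (g^-1 * (x * g))).

Definition gen (A : set G) : set G :=
  [set x | forall H : set G, is_subgroup H -> A `<=` H -> H x].

Definition derived : set G := gen [set commutator x y | x in setT & y in setT].

Definition powers (m : nat) : set G := gen [set pg_exp g m | g in setT].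

(* H has index k in G: there are exactly k left cosets, given by representatives f *)
Definition has_index (H : set G) (k : nat) : Prop :=
  exists f : 'I_k -> G, forall x : G, exists! i : 'I_k, H ((f i)^-1 * x).

Definition setmul (A B : set G) : set G :=
  [set x | exists a b, A a /\ B b /\ x = a * b].

End Defs.

(* Main.v *)
(** For p in S, call K_p the set of elements that are products of boundedly
    many commutators and p-th powers.  The group is an infinite product of
    finite perfect groups B_i, one family for each p in S, where B_i is a group
    of block matrices over a field of characteristic p.  Its unipotent centre is
    so large compared with the rest of B_i that, by counting, some element of
    B_i is not a product of i commutators and p-th powers; hence K_p is a proper
    subgroup although each B_i is perfect.  Zorn's lemma then yields dense normal
    subgroups of index p above K_p, and uncountably many of them by letting the
    excluded element live on each of an uncountable family of almost disjoint
    sets of coordinates.  On the other hand B_i is a product of 7 elements of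
    order dividing p, which are m-th powers when m is prime to p; and the torus
    of B_i shows that B_i is generated by its m-th powers for almost all i
    and every m.  A subgroup of finite index contains all m-th powers for a
    suitable m, so these facts control the subgroups of finite index. *)
Require Import Defs.
From HB Require Import structures.
From mathcomp Require Import all_boot all_order all_algebra all_fingroup.
From mathcomp Require Import all_solvable all_field ssrAC.
From mathcomp Require Import all_classical all_reals all_analysis.
From mathcomp Require Import zify ring.
Set Implicit Arguments.
Unset Strict Implicit.
Unset Printing Implicit Defensive.
Import GRing.Theory.
Local Open Scope classical_set_scope.

(** * Products of boundedly many commutators and p-th powers in a finite group *)

Section Words.
Local Open Scope group_scope.

(** Valued in [Prop] because it is applied to the trace on one factor of an arbitrary abstract
    subgroup of the product. *)
Definition is_sgrp (gT : finGroupType) (N : gT -> Prop) :=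
  [/\ N 1, forall x y, N x -> N y -> N (x * y) & forall x, N x -> N x^-1].

Definition comm_pow (gT : finGroupType) (p : nat) (t : gT * gT * gT) : gT :=
  [~ t.1.1, t.1.2] * t.2 ^+ p.

Definition comm_pow_word (gT : finGroupType) (p k : nat) (x : gT) : Prop :=
  exists2 s : seq (gT * gT * gT), size s <= k & x = \prod_(t <- s) comm_pow p t.

Section WordTheory.
Variables (gT : finGroupType) (p : nat).
Implicit Types x y : gT.

Lemma comm_pow_word1 k : comm_pow_word p k (1 : gT).
Proof. by exists [::]; rewrite ?big_nil. Qed.

Lemma comm_pow_wordW k l x : k <= l -> comm_pow_word p k x -> comm_pow_word p l x.
Proof. by move=> kl [s sk ->]; exists s => //; exact: leq_trans kl. Qed.

Lemma comm_pow_wordM k l x y :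
  comm_pow_word p k x -> comm_pow_word p l y -> comm_pow_word p (k + l) (x * y).
Proof.
move=> [s sk ->] [t tl ->]; exists (s ++ t); first by rewrite size_cat leq_add.
by rewrite big_cat.
Qed.

Lemma comm_pow_word_comm x y : comm_pow_word p 1 [~ x, y].
Proof. by exists [:: (x, y, 1)]; rewrite // big_seq1 /comm_pow expg1n mulg1. Qed.

Lemma comm_pow_word_exp x : comm_pow_word p 1 (x ^+ p).
Proof. by exists [:: (1, 1, x)]; rewrite // big_seq1 /comm_pow comm1g mul1g. Qed.

(** The inverse of [[a, b] e^p] is [(e^-1)^p [b, a]], in the wrong order for a single letter; two
    letters are spent on it, hence the doubling. *)
Lemma comm_pow_wordV k x : comm_pow_word p k x -> comm_pow_word p k.*2 x^-1.
Proof.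
case=> s sk ->; apply: (@comm_pow_wordW (size s).*2); first by rewrite leq_double.
elim: s {sk} => [|[[a b] e] s IH]; first by rewrite big_nil invg1; exact: comm_pow_word1.
rewrite big_cons invgM /= doubleS -addn2; apply: comm_pow_wordM => //.
rewrite /comm_pow /= invgM invgR -expVgn -(addn1 1).
by apply: comm_pow_wordM; [exact: comm_pow_word_exp|exact: comm_pow_word_comm].
Qed.

(** Bezout gives [u * m = p * v + 1], so [x ^+ u] is an m-th root of [x]. *)
Lemma exp_root m x : 0 < m -> coprime m p -> x ^+ p = 1 -> exists y, x = y ^+ m.
Proof.
move=> m0 /(coprimeP _ m0)[[u v] /= uv] xp; exists (x ^+ u).
rewrite -expgnA; have -> : (u * m = p * v + 1)%N by rewrite [(p * v)%N]mulnC; lia.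
by rewrite expgnDr expgnA xp expg1n mul1g.
Qed.
End WordTheory.

End Words.

(** * The finite block groups over a finite field *)

Section Block.
Variables (F : finFieldType) (d : nat).
Local Open Scope ring_scope.

(** The matrix [[1, X, Z], [0, g, Y], [0, 0, 1]] with blocks of sizes d, 2, d and
    g in SL_2. *)
Record blk := Blk {
  bX : 'M[F]_(d, 2);
  bg : 'M[F]_2;
  bY : 'M[F]_(2, d);
  bZ : 'M[F]_d;
  bdet : \det bg == 1
}.

Lemma blk_eq (x y : blk) :
  bX x = bX y -> bg x = bg y -> bY x = bY y -> bZ x = bZ y -> x = y.
Proof.
case: x y => [X g Y Z e] [X' g' Y' Z' e'] /= EX Eg EY EZ; subst.
by rewrite (bool_irrelevance e e').
Qed.

Definition blk_code (x : blk) :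
    'M[F]_(d, 2) * {g : 'M[F]_2 | \det g == 1} * 'M[F]_(2, d) * 'M[F]_d :=
  (bX x, exist _ (bg x) (bdet x), bY x, bZ x).
Definition blk_decode
    (t : 'M[F]_(d, 2) * {g : 'M[F]_2 | \det g == 1} * 'M[F]_(2, d) * 'M[F]_d) :=
  Blk t.1.1.1 t.1.2 t.2 (svalP t.1.1.2).

Lemma blk_codeK : cancel blk_code blk_decode.
Proof. by move=> x; apply: blk_eq. Qed.

HB.instance Definition _ := Finite.copy blk (can_type blk_codeK).

Lemma bunit (x : blk) : bg x \in unitmx.
Proof. by rewrite unitmxE (eqP (bdet x)) unitr1. Qed.

Lemma blk_mul_subproof (x y : blk) : \det (bg x *m bg y) == 1.
Proof. by rewrite det_mulmx (eqP (bdet x)) (eqP (bdet y)) mulr1. Qed.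
Lemma blk_one_subproof : \det (1%:M : 'M[F]_2) == 1.
Proof. by rewrite det1. Qed.
Lemma blk_inv_subproof (x : blk) : \det (invmx (bg x)) == 1.
Proof. by rewrite det_inv (eqP (bdet x)) invr1. Qed.

Definition blk_mul (x y : blk) : blk :=
  Blk (bX y + bX x *m bg y) (bg x *m bY y + bY x)
      (bZ y + bX x *m bY y + bZ x) (blk_mul_subproof x y).
Definition blk_one : blk := Blk 0 0 0 blk_one_subproof.
Definition blk_inv (x : blk) : blk :=
  Blk (- (bX x *m invmx (bg x))) (- (invmx (bg x) *m bY x))
      (bX x *m invmx (bg x) *m bY x - bZ x) (blk_inv_subproof x).

Lemma blk_mulA : associative blk_mul.
Proof.
move=> x y z; apply: blk_eq => /=.
- by rewrite mulmxDl mulmxA !addrA.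
- by rewrite mulmxA.
- by rewrite mulmxDr mulmxA !addrA.
- by rewrite mulmxDr mulmxDl !mulmxA !addrA [LHS](ACl (1*2*4*3*5*6)).
Qed.

Lemma blk_mul1 : left_id blk_one blk_mul.
Proof.
by move=> x; apply: blk_eq; rewrite /= ?mul0mx ?mul1mx ?addr0 ?mul0mx ?addr0.
Qed.

Lemma blk_mulV : left_inverse blk_one blk_inv blk_mul.
Proof.
move=> x; apply: blk_eq => /=.
- by rewrite mulNmx -mulmxA mulVmx ?bunit // mulmx1 subrr.
- by rewrite mulVmx ?bunit.
- by rewrite subrr.
- by rewrite mulNmx addrA subrK subrr.
Qed.

HB.instance Definition _ := Finite_isGroup.Build blk blk_mulA blk_mul1 blk_mulV.

Lemma bXM (x y : blk) : bX (x * y)%g = bX y + bX x *m bg y. Proof. by []. Qed.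
Lemma bgM (x y : blk) : bg (x * y)%g = bg x *m bg y. Proof. by []. Qed.
Lemma bYM (x y : blk) : bY (x * y)%g = bg x *m bY y + bY x. Proof. by []. Qed.
Lemma bZM (x y : blk) : bZ (x * y)%g = bZ y + bX x *m bY y + bZ x. Proof. by []. Qed.
Definition bM := (bXM, bgM, bYM, bZM).

Definition xi (X : 'M[F]_(d, 2)) : blk := Blk X 0 0 blk_one_subproof.
Definition eta (Y : 'M[F]_(2, d)) : blk := Blk 0 Y 0 blk_one_subproof.
Definition zeta (Z : 'M[F]_d) : blk := Blk 0 0 Z blk_one_subproof.
Definition lev (g : 'M[F]_2) (e : \det g == 1) : blk := Blk 0 0 0 e.

Lemma xiD X X' : xi (X + X') = (xi X * xi X')%g.
Proof. by apply: blk_eq; rewrite !bM /= ?mulmx1 ?mulmx0 ?mul0mx ?addr0 // addrC. Qed.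
Lemma etaD Y Y' : eta (Y + Y') = (eta Y * eta Y')%g.
Proof. by apply: blk_eq; rewrite !bM /= ?mulmx1 ?mul1mx ?mulmx0 ?mul0mx ?addr0 // addrC. Qed.
Lemma zetaD Z Z' : zeta (Z + Z') = (zeta Z * zeta Z')%g.
Proof. by apply: blk_eq; rewrite !bM /= ?mulmx1 ?mulmx0 ?mul0mx ?addr0 // addrC. Qed.

Definition mx2 (a b c e : F) : 'M[F]_2 :=
  \matrix_(i, j) if i == 0 then (if j == 0 then a else b) else (if j == 0 then c else e).

Lemma mx2M a b c e a' b' c' e' :
  mx2 a b c e *m mx2 a' b' c' e' =
  mx2 (a * a' + b * c') (a * b' + b * e') (c * a' + e * c') (c * b' + e * e').
Proof.
by apply/matrixP=> i j; rewrite !mxE !big_ord_recl big_ord0 !mxE /= addr0; do 2!case: ifP.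
Qed.

Lemma mx2E (g : 'M[F]_2) : g = mx2 (g 0 0) (g 0 1) (g 1 0) (g 1 1).
Proof.
apply/matrixP=> i j; rewrite !mxE.
have D (k : 'I_2) : (k == 0) = false -> k = 1.
  by case: k => [[|[|//]] lk] //= _; apply: val_inj.
by case: eqP => [->|/eqP/negbTE/D->]; case: eqP => [->|/eqP/negbTE/D->].
Qed.

Lemma det_mx2 a b c e : \det (mx2 a b c e) = a * e - b * c.
Proof.
rewrite (expand_det_row _ 0) !big_ord_recl big_ord0 /cofactor !det_mx11 !mxE /=.
by rewrite addr0 expr0 expr1 mul1r mulN1r mulrN.
Qed.

Lemma mx2_1 : mx2 1 0 0 1 = 1%:M.
Proof. by rewrite [RHS]mx2E !mxE. Qed.

Lemma det_ux a : \det (mx2 1 a 0 1) == 1. Proof. by rewrite det_mx2; apply/eqP; ring. Qed.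
Lemma det_uy a : \det (mx2 1 0 a 1) == 1. Proof. by rewrite det_mx2; apply/eqP; ring. Qed.
Lemma det_h (s : F) : s != 0 -> \det (mx2 s 0 0 s^-1) == 1.
Proof. by move=> s0; rewrite det_mx2 mulfV // mulr0 subr0. Qed.

Definition ux a := lev (det_ux a).
Definition uy a := lev (det_uy a).

Lemma lev_torusX s (s0 : s != 0) m (sm0 : s ^+ m != 0) :
  (lev (det_h s0) ^+ m)%g = lev (det_h sm0).
Proof.
suff E k : (lev (det_h s0) ^+ k)%g = lev (det_h (expf_neq0 k s0)).
  by rewrite E; apply: blk_eq.
elim: k => [|k IH]; first by apply: blk_eq; rewrite //= expr0 invr1 mx2_1.
rewrite expgS IH; apply: blk_eq; rewrite !bM /= ?(mulmx0, mul0mx, addr0) // mx2M.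
by rewrite !(mul0r, mulr0, addr0, add0r) exprS invfM.
Qed.

Lemma uxD a b : ux (a + b) = (ux a * ux b)%g.
Proof.
apply: blk_eq; rewrite !bM /= ?mulmx0 ?mul0mx ?addr0 // mx2M.
by congr mx2; ring.
Qed.
Lemma uyD a b : uy (a + b) = (uy a * uy b)%g.
Proof.
apply: blk_eq; rewrite !bM /= ?mulmx0 ?mul0mx ?addr0 // mx2M.
by congr mx2; ring.
Qed.

Lemma lev_elementary g e :
  exists t u w v, @lev g e = (uy t * ux u * uy w * ux v)%g.
Proof.
have det1 := eqP e; rewrite (mx2E g) det_mx2 in det1.
set a : F := g 0 0 in det1 *; set b : F := g 0 1 in det1 *.
set c : F := g 1 0 in det1 *; set f : F := g 1 1 in det1 *.
have [t ct] : exists t : F, c - t * a != 0.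
  have [c0|] := eqVneq c 0; last by exists 0; rewrite mul0r subr0.
  (* With c = 0 the determinant condition reads a f = 1, so a is nonzero. *)
  exists 1; rewrite c0 sub0r mul1r oppr_eq0; apply: contra_eq_neq det1 => ->.
  by rewrite c0 mul0r mulr0 subr0 eq_sym oner_eq0.
(* Once the lower left entry c' is nonzero, the matrix is a product of the form
   upper * lower * upper, the middle factor having entry c'. *)
set c' : F := c - t * a in ct; set f' : F := f - t * b.
exists t, ((a - 1) / c'), c', ((f' - 1) / c').
apply: blk_eq; rewrite !bM /= ?(mulmx0, mul0mx, addr0) // !mx2M.
rewrite (mx2E g) -/a -/b -/c -/f.
congr mx2; rewrite /f' /c' in ct *.
- by field.
- apply/(mulIf ct); transitivity (a * f - t * b * a - 1); last by field.
  by rewrite -det1; ring.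
- by field.
- apply/(mulIf ct).
  transitivity (t * (a * f - t * b * a - 1) + (f - t * b) * (c - t * a)); last by field.
  by rewrite -det1; ring.
Qed.

(** The Levi part is split off on the left. It acts on the [eta] factor, hence [invmx (bg x)] in
    [Y]; and [xi X * eta Y] creates the corner [X *m Y], which the [zeta] factor corrects. *)
Lemma blk_elementary (x : blk) : exists t u w v X Y Z,
  x = (uy t * ux u * uy w * ux v * xi X * eta Y * zeta Z)%g.
Proof.
have [t [u [w [v E]]]] := lev_elementary (bdet x).
pose Y := invmx (bg x) *m bY x.
exists t, u, w, v, (bX x), Y, (bZ x - bX x *m Y).
rewrite -E -!mulgA; apply: blk_eq;
  rewrite !bM /= ?mul0mx ?mulmx1 ?mulmx0 ?mul1mx ?addr0 ?add0r //.
  by rewrite /Y mulmxA mulmxV ?mul1mx ?bunit.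
by rewrite subrK.
Qed.

Lemma additive_exp (V : zmodType) (f : V -> blk) (a : V) n :
  (forall a b, f (a + b) = (f a * f b)%g) -> f (a *+ n) = (f a ^+ n)%g.
Proof.
move=> fD; elim: n => [|n IH]; last by rewrite mulrS fD IH expgS.
by apply: (mulgI (f 0)); rewrite -fD mulg1 addr0.
Qed.

(** Each of the seven elementary factors is the image of an additive group killed by p. *)
Lemma blk_prod7 p (x : blk) : p \in [pchar F] ->
  exists2 e : 'I_7 -> blk, forall j, (e j ^+ p = 1)%g & x = (\prod_(j < 7) e j)%g.
Proof.
move=> pF; have [t [u [w [v [X [Y [Z ->]]]]]]] := blk_elementary x.
pose s := [:: uy t; ux u; uy w; ux v; xi X; eta Y; zeta Z].
exists (fun j : 'I_7 => nth 1%g s j); last by rewrite !big_ord_recl big_ord0 /= mulg1 !mulgA.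
have f0 (V : zmodType) (f : V -> blk) : (forall a b, f (a + b) = (f a * f b)%g) -> f 0 = 1%g.
  by move=> /(@additive_exp V f 0 0).
have mx0 m n (A : 'M[F]_(m, n)) : A *+ p = 0.
  by rewrite -scaler_nat (pcharf0 pF) scale0r.
have sc0 (a : F) : a *+ p = 0 by rewrite -mulr_natl (pcharf0 pF) mul0r.
case=> [[|[|[|[|[|[|[|//]]]]]]] /= _];
  rewrite -additive_exp ?mx0 ?sc0 ?f0 //;
  by [exact: uyD|exact: uxD|exact: xiD|exact: etaD|exact: zetaD].
Qed.

(** * Generation of a block by commutators with a torus element *)

Section Generation.
Variables (N : blk -> Prop) (s : F) (s0 : s != 0) (s2 : s ^+ 2 != 1).
Hypothesis Ngrp : is_sgrp N.
Hypothesis Nnorm : forall x y : blk, N x -> N (x ^ y)%g.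
Let h := lev (det_h s0).
(** This form covers both applications: [N] contains all commutators, or [N] is normal and contains
    [h]. *)
Hypothesis Ntorus : forall y : blk, N [~ h, y]%g.

(** Clears the inverses from a commutator identity before matrix entries are compared. *)
Let commE (x y z : blk) : (y * x * z = x * y)%g -> ([~ x, y] = z)%g.
Proof. by move=> E; rewrite commgEl /conjg -E -!mulgA !mulKg. Qed.

Let subs1 : s - 1 != 0.
Proof. by rewrite subr_eq0; apply: contraNneq s2 => ->; rewrite expr1n. Qed.
Let sub1s : 1 - s != 0. Proof. by rewrite -oppr_eq0 opprB. Qed.
Let sub1s2 : 1 - s ^+ 2 != 0. Proof. by rewrite subr_eq0 eq_sym. Qed.
Let subs21 : s ^+ 2 - 1 != 0. Proof. by rewrite subr_eq0. Qed.

Local Ltac blk_calc :=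
  apply: commE; apply: blk_eq;
  rewrite !bM /= ?(mulmx0, mul0mx, mulmx1, mul1mx, addr0, add0r) //.

(** Conjugation by [h] rescales the root group: [[~ h, ux b]] is [ux ((1 - s^-2) b)], and the scalar
    is invertible since [s ^+ 2 != 1]. *)
Lemma N_ux a : N (ux a).
Proof.
suff <- : [~ h, ux (a * s ^+ 2 / (s ^+ 2 - 1))%R]%g = ux a by apply: Ntorus.
blk_calc; rewrite !mx2M; congr mx2; try ring.
by field; rewrite ?s0 ?subs1 ?sub1s ?sub1s2 ?subs21.
Qed.

Lemma N_uy a : N (uy a).
Proof.
suff <- : [~ h, uy (a / (1 - s ^+ 2))%R]%g = uy a by apply: Ntorus.
blk_calc; rewrite !mx2M; congr mx2; try ring.
by field; rewrite ?s0 ?subs1 ?sub1s ?sub1s2 ?subs21.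
Qed.

(** With [h] read as a diagonal matrix, [[~ h, xi X]] is [xi (X (1 - h))]; [k] is the inverse of
    [1 - h]. *)
Lemma N_xi X : N (xi X).
Proof.
pose k := mx2 (1 - s)^-1 0 0 (s / (s - 1)).
suff <- : [~ h, xi (X *m k)]%g = xi X by apply: Ntorus.
blk_calc; rewrite -mulmxA -{1}[X]mulmx1 -mulmxDr; congr (_ *m _).
rewrite mx2M -mx2_1; apply/matrixP=> i j; rewrite !mxE.
by do 2!case: ifP => _; field; rewrite ?s0 ?subs1 ?sub1s ?sub1s2 ?subs21.
Qed.

(** Now [h^-1] acts from the left, so [k] is the inverse of [1 - h^-1]. *)
Lemma N_eta Y : N (eta Y).
Proof.
pose k := mx2 (s / (s - 1)) 0 0 (1 - s)^-1.
suff <- : [~ h, eta (k *m Y)]%g = eta Y by apply: Ntorus.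
blk_calc; rewrite mulmxA -mulmxDl; congr (_ *m _).
rewrite mx2M; apply/matrixP=> i j; rewrite !mxE.
by do 2!case: ifP => _; field; rewrite ?s0 ?subs1 ?sub1s ?sub1s2 ?subs21.
Qed.

(** Since [h] centralises [zeta Z], the torus gives nothing directly. Instead [[~ xi X, eta Y]] is
    [zeta (X *m Y)], and every matrix unit is such a product. *)
Lemma N_zeta Z : N (zeta Z).
Proof.
have [N1 NM NV] := Ngrp.
have Nrank1 (X : 'M[F]_(d, 2)) (Y : 'M[F]_(2, d)) : N (zeta (X *m Y)).
  suff <- : [~ xi X, eta Y]%g = zeta (X *m Y).
    by apply: NM; [apply/NV/N_xi | apply/Nnorm/N_xi].
  by blk_calc.
have N0 : N (zeta 0) by [].
rewrite [Z]matrix_sum_delta.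
have Nsum (I : finType) (f : I -> 'M[F]_d) : (forall i, N (zeta (f i))) -> N (zeta (\sum_i f i)).
  by move=> Nf; elim/big_ind: _ => // A B NA NB; rewrite zetaD; apply: NM.
apply/Nsum => i; apply/Nsum => j.
by rewrite -(mul_delta_mx (0 : 'I_2)) scalemxAr.
Qed.

Lemma blk_generation (x : blk) : N x.
Proof.
have [_ NM _] := Ngrp.
by have [t [u [w [v [X [Y [Z ->]]]]]]] := blk_elementary x;
  do ![exact: N_ux|exact: N_uy|exact: N_xi|exact: N_eta|exact: N_zeta|apply/NM].
Qed.
End Generation.

(** * Counting the values of words *)

Section Counting.
Variable p : nat.
Hypothesis pF : p \in [pchar F].

(** Defined on all triples of matrices, with default value 1 off determinant 1, so that [card_mx]
    counts its domain. *)
Let section (t : 'M[F]_(d, 2) * 'M[F]_2 * 'M[F]_(2, d)) : blk :=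
  match @idP (\det t.1.2 == 1) with
  | ReflectT e => Blk t.1.1 t.2 0 e
  | _ => 1%g
  end.
Let proj (x : blk) := (bX x, bg x, bY x).

Lemma zeta_comm Z x : commute (zeta Z) x.
Proof.
by apply: blk_eq; rewrite !bM /= ?mulmx1 ?mul1mx ?mulmx0 ?mul0mx ?add0r ?addr0 // addrC.
Qed.

Lemma sectionE x : x = (section (proj x) * zeta (bZ x))%g.
Proof.
rewrite /section; case: {-}_ / idP => [e|[]]; last exact: bdet.
by apply: blk_eq; rewrite !bM /= ?mulmx1 ?mul1mx ?mulmx0 ?mul0mx ?add0r ?addr0.
Qed.

(** The factor zeta (bZ x) of x is central of exponent p, so it is invisible to
    commutators and p-th powers. *)
Lemma comm_pow_section (t : blk * blk * blk) :
  comm_pow p t = comm_pow p (section (proj t.1.1), section (proj t.1.2), section (proj t.2)).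
Proof.
have zc1 Z x : [~ zeta Z, x]%g = 1%g by apply/eqP/commgP/zeta_comm.
have zc2 Z x : [~ x, zeta Z]%g = 1%g by apply/eqP/commgP/commute_sym/zeta_comm.
have zJ x Z : (x ^ zeta Z)%g = x by apply/conjg_fixP/eqP.
have zp Z : (zeta Z ^+ p)%g = 1%g.
  rewrite -(additive_exp _ _ zetaD) -scaler_nat (pcharf0 pF) scale0r.
  by apply: blk_eq.
case: t => [[a b] e]; rewrite /comm_pow /=.
rewrite {1}(sectionE a) {1}(sectionE b) {1}(sectionE e).
rewrite commMgJ zc1 mulg1 zJ commgMJ zc2 mul1g zJ expgMn; last first.
  exact/commute_sym/zeta_comm.
by rewrite zp mulg1.
Qed.

(** There are at most q^(4d+4) triples (X, g, Y), hence at most q^(12k(d+1))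
    words of length k, against q^(d^2) values of Z. *)
Lemma not_comm_pow_word k : (12 * k * d.+1 < d ^ 2)%N ->
  exists x : blk, ~ comm_pow_word p k x.
Proof.
move=> lt_kd.
pose T := ('M[F]_(d, 2) * 'M[F]_2 * 'M[F]_(2, d))%type.
pose val (t : k.-tuple (T * T * T)) : blk :=
  (\prod_(u <- t) comm_pow p (section u.1.1, section u.1.2, section u.2))%g.
have [sub|] := boolP ([set: blk]%SET \subset codom val); last first.
  case/subsetPn=> x _ nx; exists x => -[s sk xE]; case/negP: nx.
  (* Shorter words are padded to length exactly [k] by trivial letters, of value 1. *)
  pose s' := s ++ nseq (k - size s) (1, 1, 1)%g.
  pose pr (t : blk * blk * blk) := (proj t.1.1, proj t.1.2, proj t.2).
  have sz : size (map pr s') == k by rewrite size_map size_cat size_nseq subnKC.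
  apply/codomP; exists (Tuple sz).
  rewrite /val /= big_map (eq_bigr _ (fun t _ => esym (comm_pow_section t))).
  rewrite big_cat /= -xE big1_seq ?mulg1 // => t /andP[_ /nseqP[-> _]].
  by rewrite /comm_pow /= comm1g expg1n mulg1.
have qgt1 : (1 < #|F|)%N.
  by rewrite (cardD1 0) (cardD1 1) !inE oner_neq0.
suff: (#|F| ^ (d ^ 2) <= #|F| ^ (12 * k * d.+1))%N by rewrite leq_exp2l // leqNgt lt_kd.
have cardZ : (#|F| ^ (d ^ 2) <= #|{: blk}|)%N.
  rewrite -[(d ^ 2)%N]mulnn -card_mx.
  by apply: (leq_card zeta) => A B [].
apply: (leq_trans cardZ); rewrite -cardsT.
apply: (leq_trans (subset_leq_card sub)).
apply: (leq_trans (leq_image_card _ _)).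
rewrite card_tuple !card_prod !card_mx -!expnD -expnM leq_exp2l //.
by lia.
Qed.
End Counting.

(** There are at most m roots of unity of order dividing m, and more than m nonzero elements. *)
Lemma exists_torus m : (0 < m)%N -> (m.+1 < #|F|)%N -> exists2 s : F, s != 0 & s ^+ m != 1.
Proof.
move=> m0 mF; pose P := enum [pred x : F | x != 0].
have [|nall] := boolP (all m.-unity_root P).
  move/(max_unity_roots m0)/(_ (enum_uniq _)); rewrite -cardE.
  by rewrite (cardC1 (0 : F)) -ltnS => /(leq_trans (leqSpred _)); rewrite leqNgt mF.
have /allPn[s] := nall; rewrite mem_enum inE => s0 sm; exists s => //.
by move: sm; rewrite unity_rootE.
Qed.

End Block.

(** The one parameter [n] bounds both the exponents and the word length; it will tend to infinity
    along the product. *)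
Lemma finite_block (p n : nat) : prime p -> exists gT : finGroupType,
  [/\ forall N : gT -> Prop, is_sgrp N -> (forall x y, N [~ x, y]%g) -> forall x, N x,
      forall m, (0 < m <= n)%N -> forall N : gT -> Prop, is_sgrp N ->
        (forall x, N (x ^+ m)%g) -> forall x, N x,
      forall x : gT, exists2 e : 'I_7 -> gT,
        forall j, (e j ^+ p = 1)%g & x = (\prod_(j < 7) e j)%g
    & exists x : gT, ~ comm_pow_word p n x].
Proof.
move=> pr_p; have k0 : (0 < 2 * n + 4)%N by rewrite addn4.
have [F pF cardF] := pPrimePowerField pr_p k0.
(* Going up to [n.+1] makes m = 1 available even when n = 0. *)
have ltF m : (m <= n.+1)%N -> ((2 * m).+1 < #|F|)%N.
  move=> mn; rewrite cardF; apply: (@leq_trans (2 ^ (2 * n + 4))%N).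
    by apply: leq_trans (ltn_expl _ (ltnSn 1)); lia.
  by rewrite leq_exp2r ?prime_gt1.
(* This gives [12 * n * d.+1 <= 24 * n * d < d ^ 2], as the counting requires. *)
pose d := (24 * n.+1)%N; exists (blk F d); split.
- move=> N gN Nc; have [|s s0 s2] := @exists_torus F 2 isT; first exact: (ltF 1%N).
  apply: (blk_generation (s0 := s0) s2 gN) => // x y Nx.
  have [_ NM _] := gN; rewrite -[(x ^ y)%g](mulKVg x); apply: NM => //; apply: Nc.
- move=> m /andP[m0 mn] N gN Nm x0.
  have [N1 NM NV] := gN.
  (* The exponent [2 * m] ensures that the square of [s ^+ m] is not 1. *)
  have [||s s0 sm] := @exists_torus F (2 * m); [by rewrite muln_gt0|exact/ltF/leqW|].
  have sm0 : (s ^+ m != 0)%R by rewrite expf_neq0.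
  have sm2 : ((s ^+ m) ^+ 2 != 1)%R by rewrite -exprM mulnC.
  (* The generation criterion asks for normality, so [N] is replaced by its core, which still
     contains all m-th powers because their conjugates are m-th powers. *)
  pose N' (x : blk F d) := forall y, N (x ^ y)%g.
  suff: N' x0 by move/(_ 1%g); rewrite conjg1.
  have gN' : is_sgrp N'.
    split=> [y|x x' Nx Nx' y|x Nx y]; first by rewrite conj1g.
      by rewrite conjMg; apply: NM.
    by rewrite conjVg; apply: NV.
  have NJ x y : N' x -> N' (x ^ y)%g by move=> Nx z; rewrite -conjgM.
  apply: (blk_generation (s0 := sm0) sm2 gN' NJ) => y.
  have N'h : N' (lev d (det_h sm0)).
    by move=> z; rewrite -(lev_torusX _ s0) conjXg.
  have [_ NM' NV'] := gN'.
  by rewrite commgEl; apply: NM'; [apply: NV' | apply: NJ].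
- by move=> x; apply: blk_prod7.
- by apply: not_comm_pow_word => //; rewrite /d; nia.
Qed.

(** * Abstract subgroups of a profinite group *)

Section GroupStructure.
Variable G : profinite_group.

Lemma pg_mulgV : right_inverse (pg_one G) (pg_inv G) (pg_mul G).
Proof.
move=> x; rewrite -[LHS]pg_mul1g -{1}(pg_mulVg G (pg_inv G x)) -pg_mulA.
by rewrite (pg_mulA G (pg_inv G x)) pg_mulVg pg_mul1g pg_mulVg.
Qed.

Lemma pg_mulg1 : right_id (pg_one G) (pg_mul G).
Proof. by move=> x; rewrite -(pg_mulVg G x) pg_mulA pg_mulgV pg_mul1g. Qed.
End GroupStructure.

HB.instance Definition _ (G : profinite_group) :=
  isGroup.Build (pg_carrier G) (@pg_mulA G) (@pg_mul1g G) (@pg_mulg1 G)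
    (@pg_mulVg G) (@pg_mulgV G).

Section Profinite.
Local Open Scope group_scope.
Variable G : profinite_group.
Implicit Types (H K C : set G) (x y g : G).

Lemma pg_expE x n : pg_exp G x n = x ^+ n.
Proof. by elim: n => [|n IH] //=; rewrite IH expgS. Qed.

Lemma subgroup1 H : is_subgroup G H -> H 1. Proof. by case. Qed.
Lemma subgroupM H x y : is_subgroup G H -> H x -> H y -> H (x * y).
Proof. by case=> _ [HM _]; apply: HM. Qed.
Lemma subgroupV H x : is_subgroup G H -> H x -> H x^-1.
Proof. by case=> _ [_ HV]; apply: HV. Qed.
Lemma subgroupX H x n : is_subgroup G H -> H x -> H (x ^+ n).
Proof.
move=> sH Hx; elim: n => [|n IH]; first by rewrite expg0; exact: subgroup1.
by rewrite expgS; exact: subgroupM.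
Qed.
Lemma subgroup_Mr H x y : is_subgroup G H -> H y -> H (x * y) -> H x.
Proof.
by move=> sH Hy Hxy; rewrite -(mulgK y x); apply: subgroupM => //; exact: subgroupV.
Qed.
Lemma subgroup_Ml H x y : is_subgroup G H -> H x -> H (x * y) -> H y.
Proof.
by move=> sH Hx Hxy; rewrite -(mulKg x y); apply: subgroupM => //; exact: subgroupV.
Qed.
Lemma subgroup_div H x y z : is_subgroup G H -> H (x^-1 * y) -> H (x^-1 * z) -> H (y^-1 * z).
Proof.
move=> sH /(subgroupV sH); rewrite invgM invgK => Hyx Hxz.
by have := subgroupM sH Hyx Hxz; rewrite -mulgA mulVKg.
Qed.

Lemma gen_subgroup (A : set G) : is_subgroup G (gen G A).
Proof.
split; first by move=> H sH _; exact: subgroup1.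
split=> [x y Ax Ay H sH AH|x Ax H sH AH].
  by apply: subgroupM => //; [exact: Ax|exact: Ay].
by apply: subgroupV => //; exact: Ax.
Qed.

Lemma sub_gen (A : set G) : A `<=` gen G A.
Proof. by move=> x Ax H _; apply. Qed.

Lemma derived_comm x y : derived G [~ x, y].
Proof. by apply: sub_gen; exists x => //; exists y. Qed.

Lemma derived_min H : is_subgroup G H -> (forall x y, H [~ x, y]) -> derived G `<=` H.
Proof. by move=> sH HC x; apply=> // _ [y _ [z _ <-]]; exact: HC. Qed.

Lemma powers_exp m x : powers G m (x ^+ m).
Proof. by apply: sub_gen; exists x => //; rewrite pg_expE. Qed.

Lemma powers_min m H : is_subgroup G H -> (forall x, H (x ^+ m)) -> powers G m `<=` H.
Proof. by move=> sH HC x; apply=> // _ [y _ <-]; rewrite pg_expE; exact: HC. Qed.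

Lemma powers_prod m n (F : 'I_n -> G) : powers G m (\prod_(j < n) F j ^+ m).
Proof.
have sP : is_subgroup G (powers G m) := gen_subgroup _.
elim/big_rec: _ => [|j z _ Dz]; first exact: (subgroup1 sP).
by apply: (subgroupM sP) => //; exact: powers_exp.
Qed.

(** * The action on the cosets of a subgroup of finite index *)

Section CosetAction.
Variables (H : set G) (k : nat) (f : 'I_k -> G).
Hypothesis sH : is_subgroup G H.
Hypothesis fP : forall x, exists! i, H ((f i)^-1 * x).

(** coset_idx x is the index of the left coset x H. *)
Definition coset_idx x : 'I_k := projT1 (cid (fP x)).

Lemma coset_idxP x : H ((f (coset_idx x))^-1 * x).
Proof. by rewrite /coset_idx; case: cid => i []. Qed.

Lemma coset_idx_uniq x i : H ((f i)^-1 * x) -> coset_idx x = i.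
Proof. by rewrite /coset_idx; case: cid => j [/= _]; apply. Qed.

Lemma coset_idxE x y : coset_idx x = coset_idx y <-> H (x^-1 * y).
Proof.
split=> [E|Hxy]; first by apply: (subgroup_div sH (coset_idxP x)); rewrite E; exact: coset_idxP.
apply: coset_idx_uniq; have := coset_idxP y => Hy.
apply: (@subgroup_Mr _ _ (x^-1 * y)) => //.
by rewrite -mulgA mulVKg.
Qed.

Lemma coset_idxf i : coset_idx (f i) = i.
Proof. by apply: coset_idx_uniq; rewrite mulVg; exact: subgroup1. Qed.

Lemma coset_act_inj g : injective (fun i => coset_idx (g * f i)).
Proof.
move=> i j /coset_idxE; rewrite invgM -mulgA mulKg => /coset_idxE.
by rewrite !coset_idxf.
Qed.

Definition coset_act g : 'S_k := perm (coset_act_inj (g := g)).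

Lemma coset_act_idx g x : coset_act g (coset_idx x) = coset_idx (g * x).
Proof.
rewrite permE; apply/coset_idxE; rewrite invgM -mulgA mulKg; exact: coset_idxP.
Qed.

(** The order is reversed because permutations compose from left to right while the group acts on
    left cosets from the left. *)
Lemma coset_actM g h : coset_act (g * h) = coset_act h * coset_act g.
Proof. by apply/permP=> i; rewrite permM -(coset_idxf i) !coset_act_idx mulgA. Qed.

Lemma coset_act1 : coset_act 1 = 1.
Proof. by apply/permP=> i; rewrite perm1 -(coset_idxf i) coset_act_idx mul1g. Qed.

Lemma coset_actV g : coset_act g^-1 = (coset_act g)^-1.
Proof. by apply: (mulgI (coset_act g)); rewrite mulgV -coset_actM mulVg coset_act1. Qed.

Lemma coset_actX g n : coset_act (g ^+ n) = coset_act g ^+ n.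
Proof. by elim: n => [|n IH]; rewrite ?expg0 ?coset_act1 // expgSr coset_actM IH expgS. Qed.

Lemma coset_act_eq1 g : coset_act g = 1 -> H g.
Proof.
move=> g1; rewrite -[g]mul1g -invg1; apply/coset_idxE.
by rewrite -[in RHS](mulg1 g) -coset_act_idx g1 perm1.
Qed.

Lemma subgroup_index_fact g : H (g ^+ k`!).
Proof.
apply: coset_act_eq1; rewrite coset_actX -card_Sn -cardsT.
by apply: expg_cardG; rewrite inE.
Qed.

Hypothesis nH : forall g x, H x -> H (g^-1 * (x * g)).

Definition coset_img : {set 'S_k} := [set s | `[< exists g, s = coset_act g >]]%SET.

Lemma mem_coset_img g : coset_act g \in coset_img.
Proof. by rewrite inE; apply/asboolP; exists g. Qed.

Lemma coset_img_group_set : group_set coset_img.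
Proof.
apply/group_setP; split; first by rewrite -coset_act1 mem_coset_img.
by move=> s t; rewrite !inE => -[g ->] [h ->]; exists (h * g); rewrite coset_actM.
Qed.
Canonical coset_img_group := Group coset_img_group_set.

(** For normal [H] a permutation in the image is determined by its value at the coset of 1. *)
Lemma card_coset_img : #|coset_img| = k.
Proof.
pose i0 := coset_idx 1.
rewrite -[RHS](card_ord k) -cardsT -(@card_in_imset _ _ (fun s : 'S_k => s i0) coset_img).
  apply: eq_card => i; rewrite inE; apply/imsetP; exists (coset_act (f i)).
    exact: mem_coset_img.
  by rewrite coset_act_idx mulg1 coset_idxf.
move=> _ _ /[!inE] -[g ->] [h ->].
rewrite !coset_act_idx !mulg1 => /coset_idxE Hgh; apply/permP=> i.
rewrite -(coset_idxf i) !coset_act_idx; apply/coset_idxE.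
by have := nH (f i) Hgh; rewrite invgM !mulgA.
Qed.

Lemma normal_index_exp g : H (g ^+ k).
Proof.
have := expg_cardG (mem_coset_img g); rewrite card_coset_img -coset_actX.
exact: coset_act_eq1.
Qed.

Lemma normal_prime_index_comm g h : prime k -> H [~ g, h].
Proof.
move=> pr_k; apply: coset_act_eq1.
have /cyclic_abelian/centsP ab : cyclic coset_img by rewrite prime_cyclic ?card_coset_img.
have E : commute (coset_act g) (coset_act h) by apply: ab; exact: mem_coset_img.
rewrite commgEl /conjg !coset_actM !coset_actV.
by rewrite -E mulgK mulgV.
Qed.

End CosetAction.

Lemma powers_fact_sub H k : is_subgroup G H -> has_index G H k -> powers G k`! `<=` H.
Proof. by move=> sH [f fP]; apply: powers_min => // a; exact: (subgroup_index_fact sH fP). Qed.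

Lemma powers_index_sub H k : is_normal G H -> has_index G H k -> powers G k `<=` H.
Proof.
by move=> [sH nH] [f fP]; apply: powers_min => // a; exact: (normal_index_exp sH fP nH).
Qed.

Lemma derived_prime_index_sub H k :
  is_normal G H -> has_index G H k -> prime k -> derived G `<=` H.
Proof.
move=> [sH nH] [f fP] pr_k; apply: derived_min => // a b.
exact: (normal_prime_index_comm sH fP nH).
Qed.

(** * Oversubgroups, open subgroups and compactness *)

(** An oversubgroup is determined by which of the [f i] it contains. As [C] is just a set, this
    serves finite index and open neighbourhoods of 1 alike. *)
Lemma finite_oversubgroups C (k : nat) (f : 'I_k -> G) :
  (forall x, exists i, C ((f i)^-1 * x)) ->
  finite_set [set H | is_subgroup G H /\ C `<=` H].
Proof.
move=> fP; pose union (A : {set 'I_k}) : set G := [set x | exists2 i, i \in A & C ((f i)^-1 * x)].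
apply: (@sub_finite_set _ _ (union @` setT)); last exact/finite_image/finite_finset.
move=> H [sH CH]; exists [set i | `[< H (f i) >]]%SET => //.
apply/seteqP; split=> x /=.
  by case=> i; rewrite inE => /asboolP Hi /CH /(subgroupM sH Hi); rewrite mulVKg.
move=> Hx; have [i Ci] := fP x; exists i => //; rewrite inE; apply/asboolP.
have := subgroupM sH Hx (subgroupV sH (CH _ Ci)).
by rewrite invgM invgK mulVKg.
Qed.

Lemma finite_index_oversubgroups C k : has_index G C k ->
  finite_set [set H | is_subgroup G H /\ C `<=` H].
Proof.
by case=> f fP; apply: (finite_oversubgroups (f := f)) => x; have [i []] := fP x; exists i.
Qed.

Lemma mulg_continuous_l x : continuous (fun y : G => x * y).
Proof.
move=> y; apply: (@continuous_comp _ _ _ (fun y : G => (x, y)) (fun p => p.1 * p.2)).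
  by apply: cvg_pair; [exact: cvg_cst|exact: cvg_id].
exact: pg_mul_cont.
Qed.

(** By compactness finitely many translates of [C] cover the group. *)
Lemma open_oversubgroups C : open C -> C 1 ->
  finite_set [set H | is_subgroup G H /\ C `<=` H].
Proof.
move=> oC C1; pose T : ptopologicalType := HB.pack (Topological.sort (pg_carrier G))
  (isPointed.Build (Topological.sort (pg_carrier G)) (pg_one G)).
have cG : @cover_compact T [set: T] by rewrite -compact_cover; exact: pg_compact.
have [||D _ GD] := cG G setT (fun y => [set x | C (y^-1 * x)]).
- move=> y _; apply: (@open_comp _ _ (fun x => y^-1 * x)) => // x _.
  exact: mulg_continuous_l.
- by move=> x _; exists x => //=; rewrite mulVg.
pose s := finmap.enum_fset D.
pose f (i : 'I_(size s)) : G := nth 1 s i.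
apply: (finite_oversubgroups (f := f)) => x.
have [y /= yD Cx] := GD x I.
have yi : (index y s < size s)%N by rewrite index_mem.
by exists (Ordinal yi); rewrite /f /= nth_index.
Qed.

Lemma open_subgroup_closed H : is_subgroup G H -> open H -> closed H.
Proof.
move=> sH oH x clx; have : nbhs x [set y | H (x^-1 * y)].
  apply: mulg_continuous_l; apply: open_nbhs_nbhs; split => //.
  by rewrite mulVg; exact: subgroup1.
move=> /clx[y [Hy Hxy]]; rewrite -[x]invgK.
apply: subgroupV => //; exact: (subgroup_Mr sH Hy).
Qed.

Lemma subgroup_open H C : is_subgroup G H -> open C -> C 1 -> C `<=` H -> open H.
Proof.
move=> sH oC C1 CH; rewrite openE => x Hx.
have : nbhs x [set y | C (x^-1 * y)].
  by apply: mulg_continuous_l; apply: open_nbhs_nbhs; split => //; rewrite mulVg.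
apply: filterS => y /CH Hxy; exact: (subgroup_Ml sH (subgroupV sH Hx) Hxy).
Qed.

Lemma has_index_setT k : has_index G [set: G] k -> (k <= 1)%N.
Proof.
case: k => [|[|k]] // [f /(_ 1)[i [_ fi]]].
by have /(congr1 val) := etrans (esym (fi ord0 I)) (fi ord_max I).
Qed.

(** The quotient is abelian, so [H] contains the dense derived subgroup; an open [H] would be
    closed, hence everything. *)
Lemma prime_index_not_open H k : closure (derived G) = [set: G] ->
  is_normal G H -> has_index G H k -> prime k -> ~ open H.
Proof.
move=> dense nH iH pr_k oH; have cH := open_subgroup_closed (proj1 nH) oH.
have HT : H = [set: G].
  apply/seteqP; split=> // y _; apply: cH.
  by apply: (closure_subset (derived_prime_index_sub nH iH pr_k)); rewrite dense.
by rewrite HT in iH; have := has_index_setT iH; rewrite leqNgt prime_gt1.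
Qed.

Lemma subgroup_coprime H x m n : is_subgroup G H -> (0 < m)%N -> coprime m n ->
  H (x ^+ m) -> H (x ^+ n) -> H x.
Proof.
move=> sH m0 /(coprimeP _ m0)[[u v] /= uv] Hm Hn.
have E : (m * u = n * v + 1)%N by rewrite mulnC [(n * v)%N]mulnC; lia.
apply: (@subgroup_Ml H (x ^+ (n * v))) => //.
  by rewrite expgnA; exact: subgroupX.
by rewrite -expgSr -addn1 -E expgnA; exact: subgroupX.
Qed.

(** * Normal subgroups of prime index from Zorn's lemma *)

Section Maximal.
Variables (K : set G) (p : nat) (x : G).
Hypotheses (pr_p : prime p) (sK : is_subgroup G K).
Hypotheses (Kcomm : forall a b, K [~ a, b]) (Kexp : forall a, K (a ^+ p)) (Kx : ~ K x).

(** Modulo H, which contains all commutators and p-th powers, this is the group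
    generated by H and y. *)
Let cyc H y : set G := [set z | exists j, H (z * y ^+ j)].

Lemma conj_over H a b : is_subgroup G H -> K `<=` H -> H a -> H (a ^ b).
Proof. by move=> sH KH Ha; rewrite -(mulKVg a (a ^ b)) -commgEl; apply: subgroupM; auto. Qed.

Lemma swap_over H a b : is_subgroup G H -> K `<=` H -> H (a * b) -> H (b * a).
Proof. by move=> sH KH /(@conj_over _ _ a sH KH); rewrite /conjg mulgA mulKg. Qed.

Lemma cyc_subgroup H y : is_subgroup G H -> K `<=` H -> is_subgroup G (cyc H y).
Proof.
move=> sH KH; split; first by exists 0%N; rewrite expg0 mulg1; exact: subgroup1.
split=> [z w [j Hz] [l Hw]|z [j Hz]].
  exists (l + j)%N; rewrite -[pg_mul G z w]/(z * w) -mulgA; apply: (swap_over sH KH).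
  rewrite expgnDr -!mulgA mulgA; apply: subgroupM => //; exact: (swap_over sH KH).
(* A natural number congruent to -j modulo p. *)
exists (p * j - j)%N; apply: (@subgroup_Mr H _ (y ^- (p * j))) => //.
  by apply: subgroupV => //; rewrite expgnA; apply: subgroupX => //; exact: KH.
have -> : pg_inv G z * y ^+ (p * j - j) * y ^- (p * j) = z^-1 * y ^- j.
  rewrite -mulgA -[X in y ^- X](subnKC (leq_pmull j (prime_gt0 pr_p))).
  by rewrite expgnDr invgM mulVKg.
by apply: (swap_over sH KH); rewrite -invgM; exact: subgroupV.
Qed.

Lemma sub_cyc H y : H `<=` cyc H y.
Proof. by move=> z Hz; exists 0%N; rewrite expg0 mulg1. Qed.

(** H is maximal among the subgroups that contain K but not x. *)
Lemma exists_prime_index : exists H,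
  [/\ is_normal G H, K `<=` H, ~ H x & has_index G H p].
Proof.
(* set0 is allowed because Zorn_bigcup also considers the empty chain. *)
pose P : set (set G) := [set H | H = set0 \/ [/\ is_subgroup G H, K `<=` H & ~ H x]].
have [F FP totF|H [PH Hmax]] := @Zorn_bigcup G P.
  have [[X0 FX0 X0N0]|F0] := pselect (exists2 X, F X & X != set0); last first.
    left; rewrite -subset0 => z [X FX Xz]; apply: F0; exists X => //.
    by apply/set0P; exists z.
  have FP' X z : F X -> X z -> [/\ is_subgroup G X, K `<=` X & ~ X x].
    by move=> FX Xz; have [X0'|//] := FP X FX; rewrite X0' in Xz.
  move/set0P: X0N0 => [z0 X0z0]; have [sX0 KX0 X0x] := FP' _ _ FX0 X0z0.
  right; split; last first.
  - by move=> [X FX Xx]; have [_ _] := FP' _ _ FX Xx.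
  - by move=> z Kz; exists X0 => //; exact: KX0.
  split; first by exists X0 => //; exact: subgroup1.
  split=> [a b [X FX Xa] [Y FY Yb]|a [X FX Xa]]; last first.
    by exists X => //; have [sX _ _] := FP' _ _ FX Xa; exact: subgroupV.
  have [sX _ _] := FP' _ _ FX Xa; have [sY _ _] := FP' _ _ FY Yb.
  have [XY|YX] := totF _ _ FX FY.
    by exists Y => //; apply: subgroupM => //; exact: XY.
  by exists X => //; apply: subgroupM => //; exact: YX.
have [sH KH Hx] : [/\ is_subgroup G H, K `<=` H & ~ H x].
  case: PH => // H0; case: (Hmax K); last by right; split.
  by rewrite H0; split=> // /(_ 1 (subgroup1 sK)).
(* By maximality, adjoining any [y] outside [H] captures [x]. *)
have cycT y : ~ H y -> cyc H y x.
  move=> Hy; apply: contrapT => ncyc; case: (Hmax (cyc H y)).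
    split; first exact: sub_cyc.
    move=> /(_ y) cycH; apply: Hy; apply: cycH; exists p.-1.
    by rewrite -expgS prednK ?prime_gt0 //; exact: KH.
  right; split=> //; first exact: cyc_subgroup.
  by move=> z Kz; apply: sub_cyc; exact: KH.
(* The relation between [x] and [y^j] can be inverted: p does not divide j, since otherwise [x]
   would lie in [H]. So [x] generates the quotient by [H]. *)
have full y : cyc H x y.
  have [Hy|/cycT[j Hxy]] := pselect (H y); first exact: sub_cyc.
  have sT := cyc_subgroup x sH KH.
  have Tp : cyc H x (y ^+ p) by apply: sub_cyc; exact: KH.
  have Tj : cyc H x (y ^+ j) by exists 1%N; apply: (swap_over sH KH).
  apply: (subgroup_coprime sT (prime_gt0 pr_p) _ Tp Tj).
  rewrite prime_coprime //; apply/negP => /dvdnP[q jE]; apply: Hx.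
  apply: (subgroup_Mr sH _ Hxy).
  by rewrite jE mulnC expgnA; apply: subgroupX => //; exact: KH.
exists H; split => //.
  split=> // g y Hy; exact: (conj_over g sH KH Hy).
have Hxp q : H (x ^+ (p * q)) by rewrite expgnA; apply: subgroupX => //; exact: KH.
exists (fun i : 'I_p => x ^+ i) => g.
(* Taking [g^-1] yields, after inversion, the form required for left cosets. *)
have [j Hj] := full g^-1.
have {}Hj : H ((x ^+ j)^-1 * g) by have := subgroupV sH Hj; rewrite invgM invgK.
have inj i l : (i <= l < p)%N -> H ((x ^+ i)^-1 * x ^+ l) -> i = l.
  case/andP=> il lp; rewrite -{1}(subnKC il) expgnDr mulKg => Hd.
  apply/eqP; rewrite eqn_leq il leqNgt; apply/negP => ltil; apply: Hx.
  apply: (subgroup_coprime sH (prime_gt0 pr_p) _ (KH _ (Kexp x)) Hd).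
  by rewrite prime_coprime // gtnNdvd ?subn_gt0 //; lia.
have Hr : H ((x ^+ (j %% p)%N)^-1 * g).
  apply: (subgroup_div sH _ Hj).
  rewrite {1}(divn_eq j p) addnC expgnDr invgM mulgVK mulnC.
  exact: subgroupV.
exists (Ordinal (ltn_pmod j (prime_gt0 pr_p))); split=> [//|i Hi]; apply: val_inj => /=.
have HV y : H (y^-1 * g) -> H (g^-1 * y) by move=> /(subgroupV sH); rewrite invgM invgK.
have [ri|ir] := leqP (j %% p) i.
  by apply: inj; [rewrite ri ltn_ord|apply: (@subgroup_div H g); try exact: HV].
by apply/esym/inj; [rewrite ltnW ?ltn_pmod ?prime_gt0|apply: (@subgroup_div H g); try exact: HV].
Qed.

End Maximal.

End Profinite.

(** * The product of a family of finite groups *)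

Section Product.
Local Open Scope group_scope.
Variables (I : choiceType) (gT : I -> finGroupType).

Definition factor (i : I) : topologicalType := discrete_topology (gT i).
Definition product := prod_topology factor.

Definition agree (s : seq I) (x y : product) := forall i, i \in s -> x i = y i.

(** The product topology is a supremum, so convergence to [x] of the filter [F] of cylinders is
    checked one coordinate at a time. *)
Lemma nbhs_product (x : product) (U : set product) :
  nbhs x U <-> exists s, forall y, agree s y x -> U y.
Proof.
pose F : set_system product := [set V | exists s, forall y, agree s y x -> V y].
have FF : Filter F.
  split; first by exists [::].
  - move=> A B [s sA] [t tB]; exists (s ++ t) => y xy; split.
      by apply: sA => i si; apply: xy; rewrite mem_cat si.
    by apply: tB => i ti; apply: xy; rewrite mem_cat ti orbT.
  - by move=> A B AB [s sA]; exists s => y /sA /AB.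
split=> [|[s sU]].
  have : F --> x.
    apply/cvg_sup => i A [V] [[W] oW <-] Wx WA.
    by exists [:: i] => y yx; apply: WA => /=; rewrite /= yx ?mem_head.
  exact.
apply: (@filterS _ (nbhs x) _ [set y | agree s y x]) => //.
elim: s {sU} => [|i s IH]; first exact: filterE.
have nxi := @discrete_set1 (discrete_topology (gT i)) (x i).
have : nbhs x [set y : product | y i = x i] := @proj_continuous I factor i x _ nxi.
apply: filterS2 IH => y ys yi j.
by rewrite inE => /predU1P[->|/ys].
Qed.

Definition product_mul (x y : product) : product := fun i => (x i : gT i) * (y i : gT i).
Definition product_one : product := fun i => 1.
Definition product_inv (x : product) : product := fun i => (x i : gT i)^-1.

Lemma product_mulA x y z :
  product_mul x (product_mul y z) = product_mul (product_mul x y) z.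
Proof. by apply: functional_extensionality_dep => i; apply: mulgA. Qed.
Lemma product_mul1 x : product_mul product_one x = x.
Proof. by apply: functional_extensionality_dep => i; apply: mul1g. Qed.
Lemma product_mulV x : product_mul (product_inv x) x = product_one.
Proof. by apply: functional_extensionality_dep => i; apply: mulVg. Qed.

Lemma product_mul_cont : continuous (fun p : product * product => product_mul p.1 p.2).
Proof.
move=> [x y] U /nbhs_product[s sU].
exists ([set z | agree s z x], [set z | agree s z y]).
  by split; apply/nbhs_product; exists s.
by move=> [z w] [/= zx wy]; apply: sU => i si; rewrite /product_mul zx ?wy.
Qed.

Lemma product_inv_cont : continuous product_inv.
Proof.
move=> x U /nbhs_product[s sU]; apply/nbhs_product; exists s => y yx.
by apply: sU => i si; rewrite /product_inv yx.
Qed.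

Lemma product_compact : compact [set: product].
Proof.
have /tychonoff : forall i, compact [set: factor i].
  by move=> i; apply: finite_compact; exact: finite_finset.
by congr (compact _); apply/seteqP; split.
Qed.

Lemma product_hausdorff : hausdorff_space product.
Proof.
apply: hausdorff_product => i; exact: (@discrete_hausdorff (discrete_topology (gT i))).
Qed.

Lemma product_tdisc : totally_disconnected [set: product].
Proof.
have /totally_disconnected_prod : forall i, totally_disconnected [set: factor i].
  move=> i; apply: zero_dimension_totally_disconnected.
  exact: (@discrete_zero_dimension (discrete_topology (gT i))).
by congr (totally_disconnected _); apply/seteqP; split.
Qed.

Definition product_group : profinite_group :=
  @ProfiniteGroup product product_mul product_one product_inv product_mulA
    product_mul1 product_mulV product_mul_cont product_inv_cont product_compact
    product_hausdorff product_tdisc.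
Local Notation G := product_group.

Definition coord (i : I) (x : G) : gT i := (x : product) i.

Lemma coord_eq (x y : G) : (forall i, coord i x = coord i y) -> x = y.
Proof. exact: functional_extensionality_dep. Qed.

Lemma coord1 i : coord i 1 = 1. Proof. by []. Qed.
Lemma coordM i x y : coord i (x * y) = coord i x * coord i y. Proof. by []. Qed.
Lemma coordV i x : coord i x^-1 = (coord i x)^-1. Proof. by []. Qed.
Lemma coordX i x n : coord i (x ^+ n) = coord i x ^+ n.
Proof. by elim: n => [|n IH] //; rewrite !expgS coordM IH. Qed.
Lemma coordR i x y : coord i [~ x, y] = [~ coord i x, coord i y]. Proof. by []. Qed.
Lemma coord_prod i n (F : 'I_n -> G) :
  coord i (\prod_(j < n) F j) = \prod_(j < n) coord i (F j).
Proof. exact: (big_morph (coord i) (coordM i) (coord1 i)). Qed.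

Definition emb (i : I) (a : gT i) : G := dfwith (product_one : forall i, gT i) i a.

Lemma coord_emb i a : coord i (@emb i a) = a.
Proof. by rewrite /coord /emb dfwithin. Qed.
Lemma coord_emb_neq i j a : i != j -> coord j (@emb i a) = 1.
Proof. by move=> ij; rewrite /coord /emb dfwithout. Qed.

Lemma embM i : {morph @emb i : a b / a * b}.
Proof.
move=> a b; apply: coord_eq => j; rewrite coordM.
have [<-|ij] := eqVneq i j; first by rewrite !coord_emb.
by rewrite !coord_emb_neq ?mulg1.
Qed.
Lemma emb1 i : @emb i 1 = 1.
Proof. by apply: (mulgI (@emb i 1)); rewrite -embM !mulg1. Qed.
Lemma embV i a : @emb i a^-1 = (@emb i a)^-1.
Proof. by apply: (mulgI (@emb i a)); rewrite -embM !mulgV emb1. Qed.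
Lemma embX i a n : @emb i (a ^+ n) = (@emb i a) ^+ n.
Proof. by elim: n => [|n IH]; rewrite ?emb1 // !expgS embM IH. Qed.
Lemma embR i a b : @emb i [~ a, b] = [~ @emb i a, @emb i b].
Proof. by rewrite !commgEl /conjg !embM !embV. Qed.

Lemma emb_sgrp (D : set G) i : is_subgroup G D -> is_sgrp (fun a => D (@emb i a)).
Proof.
move=> sD; split=> [|a b Da Db|a Da].
- by rewrite emb1; exact: subgroup1.
- by rewrite embM; exact: subgroupM.
- by rewrite embV; exact: subgroupV.
Qed.

Definition restr (A : pred I) (x : G) : G := fun i => if A i then coord i x else 1.

Lemma coord_restr A i x : coord i (restr A x) = if A i then coord i x else 1.
Proof. by []. Qed.
Lemma restr1 A : restr A 1 = 1.
Proof. by apply: coord_eq => i; rewrite coord_restr coord1 if_same. Qed.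
Lemma restrM A : {morph restr A : x y / x * y}.
Proof.
by move=> x y; apply: coord_eq => i; rewrite coordM !coord_restr coordM; case: ifP; rewrite ?mulg1.
Qed.
Lemma restrV A x : restr A x^-1 = (restr A x)^-1.
Proof. by apply: (mulgI (restr A x)); rewrite -restrM !mulgV restr1. Qed.
Lemma restrX A x n : restr A (x ^+ n) = (restr A x) ^+ n.
Proof. by elim: n => [|n IH]; rewrite ?restr1 // !expgS restrM IH. Qed.
Lemma restrR A x y : restr A [~ x, y] = [~ restr A x, restr A y].
Proof. by rewrite !commgEl /conjg !restrM !restrV. Qed.
Lemma restr_predI A B x : restr A (restr B x) = restr (predI A B) x.
Proof.
apply: coord_eq => i; rewrite !coord_restr /=.
by case: (A i); case: (B i).
Qed.
Lemma restr_split A x : x = restr A x * restr (predC A) x.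
Proof.
by apply: coord_eq => i; rewrite coordM !coord_restr /=; case: (A i); rewrite ?mulg1 ?mul1g.
Qed.

Lemma finsupp_mem (D : set G) (s : seq I) (x : G) : is_subgroup G D ->
  (forall i, i \in s -> forall a, D (@emb i a)) ->
  (forall i, i \notin s -> coord i x = 1) -> D x.
Proof.
move=> sD; elim: s x => [|i s IH] x Ds xs.
  have -> : x = 1 by apply: coord_eq => i; rewrite xs.
  exact: subgroup1.
have -> : x = emb (coord i x) * restr (predC1 i) x.
  apply: coord_eq => j; rewrite coordM coord_restr /= eq_sym.
  have [<-|ij] := eqVneq i j; first by rewrite coord_emb mulg1.
  by rewrite coord_emb_neq ?mul1g.
apply: subgroupM => //; first by apply: Ds; rewrite mem_head.
apply: IH => [j js|j js]; first by apply: Ds; rewrite inE js orbT.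
rewrite coord_restr /=; case: eqVneq => //= ji.
by rewrite xs // inE (negbTE ji).
Qed.

Section Closure.
Variables (D : set G) (F : seq I).
Hypotheses (sD : is_subgroup G D) (DF : forall i, i \notin F -> forall a, D (@emb i a)).

(** Since [D] contains every finitely supported element off [F], only the coordinates in [F]
    constrain its closure. *)
Lemma closure_agree : closure D = [set z | exists2 d : G, D d & agree F d z].
Proof.
apply/seteqP; split=> z.
  move=> /(_ [set y | agree F y z])[|d [Dd Fd]]; last by exists d.
  by apply/nbhs_product; exists F.
move=> [/= d0]; pose d : G := d0; rewrite -/d => Dd Fd U /nbhs_product[s sU].
(* Multiplying by [u] corrects [d] to [z] on the part of [s] outside [F] without leaving [D]. *)
pose u : G := restr (fun j => (j \in s) && (j \notin F)) (d^-1 * z).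
exists (d * u); split.
  apply: subgroupM => //; apply: (@finsupp_mem _ [seq j <- s | j \notin F]) => // j.
    by rewrite mem_filter => /andP[jF _]; exact: DF.
  by rewrite mem_filter coord_restr andbC => /negbTE ->.
apply: sU => j js; rewrite -[LHS]/(coord j (d * u)) -[RHS]/(coord j z).
rewrite coordM coord_restr js /=; case: ifPn => [_|/negPn jF].
  by rewrite coordM coordV mulKVg.
by rewrite mulg1; exact: Fd.
Qed.

Lemma open_closure_agree : open (closure D).
Proof.
rewrite closure_agree openE => z [d Dd Fd]; apply/nbhs_product; exists F => y yz.
by exists d => // i iF; rewrite Fd // yz.
Qed.
End Closure.

Lemma dense_emb (D : set G) : is_subgroup G D ->
  (forall i a, D (@emb i a)) -> closure D = [set: G].
Proof.
move=> sD De; rewrite (@closure_agree D [::]) //.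
by apply/seteqP; split => // z _; exists 1 => //; exact: subgroup1.
Qed.

Lemma derived_dense :
  (forall i (N : gT i -> Prop), is_sgrp N -> (forall a b, N [~ a, b]) -> forall a, N a) ->
  closure (derived G) = [set: G].
Proof.
move=> perf; apply: dense_emb => [|i a]; first exact: gen_subgroup.
apply: (perf i (fun a => derived G (@emb i a))); first exact/emb_sgrp/gen_subgroup.
by move=> b c; rewrite embR; exact: derived_comm.
Qed.

Lemma open_closure_powers m (F : seq I) :
  (forall i, i \notin F -> forall N : gT i -> Prop, is_sgrp N ->
    (forall a, N (a ^+ m)) -> forall a, N a) ->
  open (closure (powers G m)).
Proof.
move=> pw; have sP : is_subgroup G (powers G m) := gen_subgroup _.
apply: (open_closure_agree (F := F)) => // i iF.
apply: (pw i iF (fun a => powers G m (@emb i a))); first exact: emb_sgrp.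
by move=> b; rewrite embX; exact: powers_exp.
Qed.

(** Because [n] is the same for all coordinates, coordinatewise factors assemble into [n] elements
    of the product. *)
Lemma powers_full m n :
  (forall i (a : gT i), exists e : 'I_n -> gT i, a = \prod_(j < n) e j ^+ m) ->
  powers G m = [set: G].
Proof.
move=> pw; apply/seteqP; split=> // y _.
have ex i := pw i (coord i y); pose e j : G := fun i => projT1 (cid (ex i)) j.
have -> : y = \prod_(j < n) e j ^+ m.
  apply: coord_eq => i; rewrite (projT2 (cid (ex i))) coord_prod.
  by apply: eq_bigr => j _; rewrite coordX.
exact: powers_prod.
Qed.

Section Words.
Variables (p : I -> nat) (q : nat).

(** The bound [k] is uniform in [i], which excludes elements whose coordinates need ever longer
    words. *)
Definition wordset : set G :=
  [set x | exists k, forall i, p i = q -> comm_pow_word q k (coord i x)].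

Lemma wordset_subgroup : is_subgroup G wordset.
Proof.
split; first by exists 0%N => i _; exact: comm_pow_word1.
split=> [x y [k kx] [l ly]|x [k kx]].
  by exists (k + l)%N => i pi; rewrite coordM; apply: comm_pow_wordM; [exact: kx|exact: ly].
by exists k.*2 => i pi; rewrite coordV; apply: comm_pow_wordV; exact: kx.
Qed.
Lemma wordset_comm x y : wordset [~ x, y].
Proof. by exists 1%N => i _; rewrite coordR; exact: comm_pow_word_comm. Qed.
Lemma wordset_exp x : wordset (x ^+ q).
Proof. by exists 1%N => i _; rewrite coordX; exact: comm_pow_word_exp. Qed.

(** This subgroup contains every element supported off [A]; Zorn's lemma is applied above it. *)
Lemma restr_wordset_subgroup A : is_subgroup G [set x | wordset (restr A x)].
Proof.
split; first by rewrite /= restr1; exact: (subgroup1 wordset_subgroup).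
split=> [x y /= Kx Ky|x /= Kx]; first by rewrite restrM; exact: (subgroupM wordset_subgroup).
by rewrite restrV; exact: (subgroupV wordset_subgroup).
Qed.
End Words.

End Product.

(** * Almost disjoint branches of the binary tree *)

Local Notation label := (nat * seq bool)%type.

Section Branches.
Local Open Scope group_scope.


(** The finite prefixes of [b], as nodes of the binary tree attached to [q]. *)
Definition branch (q : nat) (b : nat -> bool) (i : label) : bool :=
  (i.1 == q) && (i.2 == mkseq b (size i.2)).

(** Common prefixes are no longer than the first place [k] found where [b] and [c] differ. *)
Lemma branch_finite q b c : b <> c ->
  exists s : seq label, forall i, branch q b i -> branch q c i -> i \in s.
Proof.
move=> bc; have [k bck] : exists k, b k <> c k.
  by apply/existsNP => E; apply: bc; apply: functional_extensionality_dep.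
exists [seq (q, mkseq b j) | j <- iota 0 k.+1] => -[i1 i2] /andP[/eqP E1 /eqP ib] /andP[_ /eqP ic].
rewrite /= in E1 ib ic; rewrite {}E1.
apply/mapP; exists (size i2); last by rewrite -ib.
rewrite mem_iota /= add0n ltnS leqNgt; apply/negP => ki; apply: bck.
have := congr1 (fun t => nth false t k) (etrans (esym ib) ic).
by rewrite !nth_mkseq.
Qed.

(** Cantor's diagonal argument. *)
Lemma no_injection_bool_seq (f : (nat -> bool) -> nat) : ~ injective f.
Proof.
move=> finj; pose h n := `[< exists b, f b = n /\ ~~ b n >].
have hE : h (f h) = ~~ h (f h).
  rewrite {1}/h; apply/asboolP/idP => [[b [/finj ->]] //|nh].
  by exists h.
by case: (h (f h)) hE.
Qed.

Variables (gT : label -> finGroupType) (p w : label -> nat) (q : nat).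
Hypothesis gT_perfect : forall i (N : gT i -> Prop), is_sgrp N ->
  (forall x y, N [~ x, y]) -> forall x, N x.
Hypothesis pr_q : prime q.
Hypothesis w_size : forall i, (size i.2 <= w i)%N.
Hypothesis p_q : forall i, i.1 = q -> p i = q.
Local Notation G := (product_group gT).
Variable x : G.
Hypothesis x_word : forall i, ~ comm_pow_word (p i) (w i) (coord i x).

(** A bound [k] fails at the prefix of length [k], where words of length at least [k] do not
    suffice. *)
Lemma branch_notin_wordset b : ~ wordset p q (restr (branch q b) x).
Proof.
move=> [k kx]; pose i : label := (q, mkseq b k).
apply: (@x_word i); have := kx i (p_q (erefl : i.1 = q)).
rewrite coord_restr /branch /= size_mkseq !eqxx /= p_q //.
by apply: comm_pow_wordW; rewrite -[leqLHS](size_mkseq b); exact: w_size.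
Qed.

Lemma branch_normal b : exists H : set G,
  [/\ is_normal G H /\ has_index G H q,
      forall y, wordset p q (restr (branch q b) y) -> H y & ~ H x].
Proof.
have [y z|y|H [nH KH Hx iH]] := exists_prime_index pr_q
    (restr_wordset_subgroup gT p q (branch q b)) _ _ (@branch_notin_wordset b).
- by rewrite /= restrR; exact: wordset_comm.
- by rewrite /= restrX; exact: wordset_exp.
by exists H.
Qed.

(** Two branches b and c share only finitely many coordinates.  If one H served
    for both, it would contain everything supported off b, off c, or on finitely
    many coordinates, hence x. *)
Lemma uncountable_prime_index :
  ~ countable [set H : set G | is_normal G H /\ has_index G H q].
Proof.
have [h hP] := choice branch_normal.
case/countable_injP => g ginj; apply: (@no_injection_bool_seq (g \o h)) => b c /= gbc.
have {gbc} hbc : h b = h c.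
  by apply: ginj => //; rewrite inE; [case: (hP b)|case: (hP c)].
apply: contrapT => /(branch_finite q)[s sP].
have [[[sH _] _] Kb Hx] := hP b; have [_ Kc _] := hP c; rewrite -hbc in Kc.
have w1 : wordset p q (1 : G) by exact: (subgroup1 (wordset_subgroup gT p q)).
apply: Hx; rewrite (restr_split (branch q b) x); apply: subgroupM => //; last first.
  apply: Kb; rewrite restr_predI (_ : restr _ _ = 1) //.
  by apply: coord_eq => i; rewrite coord_restr /= andbN.
rewrite (restr_split (branch q c) (restr _ x)); apply: subgroupM => //; last first.
  apply: Kc; rewrite restr_predI (_ : restr _ _ = 1) //.
  by apply: coord_eq => i; rewrite coord_restr /= andbN.
(* What remains of [x] lives on the common labels; [H] contains each whole factor, since it contains
   commutators and the factors are perfect. *)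
apply: (finsupp_mem (s := s)) => // i.
  move=> _; apply: gT_perfect; first exact: emb_sgrp.
  move=> a a'; rewrite embR; apply: Kb.
  by rewrite restrR; exact: wordset_comm.
move=> nis; rewrite restr_predI coord_restr /=; case: ifP => // /andP[ci bi].
by rewrite (sP i bi ci) in nis.
Qed.

Lemma exists_prime_index_branch : exists H : set G,
  [/\ is_normal G H, has_index G H q & ~ H x].
Proof. by have [H [[nH iH] _ Hx]] := branch_normal (fun=> false); exists H. Qed.

End Branches.

(** * The product over all labels and its five properties *)

Theorem theorem1 (S : set nat) (HSprime : forall p, S p -> prime p)
    (HSne : exists p, S p) :
  exists G : profinite_group,
    (* (1) topologically perfect *)
    closure (derived G) = [set: G] /\
    (* (2) *)
    (forall m : nat, (0 < m)%N -> open (closure (powers G m))) /\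
    (forall k : nat, (0 < k)%N ->
       finite_set [set H : set G | is_subgroup G H /\ open H /\ has_index G H k]) /\
    (* (3) *)
    (forall m : nat, (0 < m)%N -> (forall p, S p -> coprime m p) ->
       open (powers G m) /\
       finite_set [set H : set G | is_normal G H /\ has_index G H m]) /\
    (* (4) *)
    (forall p, S p ->
       ~ (exists k, has_index G (setmul G (derived G) (powers G p)) k) /\
       ~ countable [set H : set G | is_normal G H /\ has_index G H p] /\
       (forall H : set G, is_normal G H -> has_index G H p -> ~ open H)) /\
    (* (5) *)
    ~ closed (derived G) /\
    (forall p, S p -> ~ closed (powers G p)).
Proof.
have [p0 Sp0] := HSne.
(* Labels whose first entry lies outside [S] get the default prime [p0]. *)
pose p (i : label) := if `[< S i.1 >] then i.1 else p0.
have Sp i : S (p i) by rewrite /p; case: asboolP.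
(* The term [pickle i] makes [w i] exceed any given exponent at almost all labels; [size i.2] makes
   it grow along every branch. *)
pose w (i : label) := (pickle i + size i.2)%N.
have [gT gTP] := choice (fun i => finite_block (w i) (HSprime _ (Sp i))).
have perf i (N : gT i -> Prop) :
    is_sgrp N -> (forall a b, N [~ a, b]%g) -> forall a, N a.
  by have [P _ _ _] := gTP i; exact: P.
have [x xP] : exists x : product_group gT,
    forall i, ~ comm_pow_word (p i) (w i) (coord i x).
  have ex i : exists a : gT i, ~ comm_pow_word (p i) (w i) a by have [_ _ _] := gTP i.
  by exists (fun i => projT1 (cid (ex i))) => i; exact: projT2 (cid (ex i)).
set G := product_group gT in x xP *.
have dense : closure (derived G) = [set: G] by apply: derived_dense.
have sP m : is_subgroup G (powers G m) := gen_subgroup _.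
have pow_open m : (0 < m)%N -> open (closure (powers G m)).
  (* The exceptional labels are those of code less than [m]. *)
  move=> m0; apply: (@open_closure_powers _ gT m (pmap unpickle (iota 0 m))) => i iF N sN.
  have [_ P _ _] := gTP i; apply: P => //.
  rewrite m0 /=; apply: leq_trans (leq_addr _ _); rewrite leqNgt.
  apply: contra iF => im; rewrite mem_pmap; apply/mapP; exists (pickle i).
    by rewrite mem_iota.
  by rewrite pickleK.
have pow_full m : (0 < m)%N -> (forall p, S p -> coprime m p) -> powers G m = [set: G].
  move=> m0 mS; apply: (@powers_full _ gT m 7) => i a.
  have [_ _ /(_ a)[e e1 ->] _] := gTP i.
  have [e' e'P] := choice (fun j => exp_root m0 (mS _ (Sp i)) (e1 j)).
  by exists e'; apply: eq_bigr.
have p_q q : S q -> forall i : label, i.1 = q -> p i = q.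
  by move=> Sq i iq; rewrite /p iq; case: asboolP.
have wsize i : (size i.2 <= w i)%N by rewrite leq_addl.
have uncount q : S q -> ~ countable [set H : set G | is_normal G H /\ has_index G H q].
  by move=> Sq; exact: (uncountable_prime_index perf (HSprime _ Sq) wsize (p_q _ Sq) xP).
have ex q : S q -> exists H : set G, [/\ is_normal G H, has_index G H q & ~ H x].
  by move=> Sq; exact: (exists_prime_index_branch (HSprime _ Sq) wsize (p_q _ Sq) xP).
have not_open q (H : set G) : S q -> is_normal G H -> has_index G H q -> ~ open H.
  by move=> Sq nH iH; exact: (prime_index_not_open dense nH iH (HSprime _ Sq)).
exists G; split=> //; split=> //; split.
  (* An open subgroup of index k is closed and contains all powers of exponent [k!], hence their
     open closure. *)
  move=> k k0; apply: (@sub_finite_set _ _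
    [set H | is_subgroup G H /\ closure (powers G k`!) `<=` H]).
    move=> H [sH [oH iH]]; split=> //.
    rewrite [X in _ `<=` X](closure_id H).1; last exact: open_subgroup_closed.
    by apply: closure_subset; exact: powers_fact_sub.
  apply: open_oversubgroups; first by apply: pow_open; exact: fact_gt0.
  by apply: subset_closure; exact: subgroup1.
split.
  move=> m m0 mS; have pT := pow_full m m0 mS; split; first by rewrite pT; exact: openT.
  apply: (@sub_finite_set _ _ [set H | is_subgroup G H /\ powers G m `<=` H]).
    by move=> H [nH iH]; split; [exact: (proj1 nH)|exact: powers_index_sub].
  by apply: open_oversubgroups; rewrite pT //; exact: openT.
split.
  move=> q Sq; split; last by split; [exact: uncount|move=> H; exact: not_open].
  (* A finite index would leave only finitely many oversubgroups, yet the uncountably many normal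
     subgroups of index [q] are all among them. *)
  move=> [k /finite_index_oversubgroups fin]; apply: (uncount q Sq).
  apply: finite_set_countable; apply: sub_finite_set fin => H [nH iH].
  split=> [|_ [a [b [aD [bP ->]]]]]; first exact: (proj1 nH).
  apply: (subgroupM (proj1 nH)); last exact: (powers_index_sub nH iH).
  exact: (derived_prime_index_sub nH iH (HSprime _ Sq)).
split.
  (* A closed derived subgroup would be everything by density, but it lies in a subgroup that omits
     [x]. *)
  move=> cD; have [H [nH iH]] := ex p0 Sp0; apply.
  apply: (derived_prime_index_sub nH iH (HSprime _ Sp0)).
  by apply: cD; rewrite dense.
(* If closed, the power subgroup equals its open closure, and a normal subgroup of index [q] above
   it would be open. *)
move=> q Sq cP; have [H [nH iH _]] := ex q Sq.
apply: (not_open q H Sq nH iH).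
apply: (subgroup_open (C := powers G q) (proj1 nH)); last exact: powers_index_sub.
  by rewrite ((closure_id _).1 cP); apply: pow_open; rewrite prime_gt0 ?HSprime.
exact: subgroup1.
Qed.
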